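(* $z_L(6,4)=14$.
   Context: **Classical Zarankiewicz number.** For $m\ge n\ge 2$, $z(m,n)$ is the maximum number of edges in a bipartite graph with parts $S=[m]=\{1,\dots,m\}$ and $T=[n]=\{1,\dots,n\}$ that contains no $K_{2,2}$ (equivalently, no cycle $C_4$). **Limited augmented bipartite graphs.** Let $G_1=(S,T,E_1)$ with $S=[m]$, $T=[n]$ be a $C_4$-free bipartite graph with $|E_1|=z(m,n)$. A limited augmented bipartite graph $G=(S,T,E_1\cup E_2)$ augmented from $G_1$ consists of the set $E_1$ of 1-edges (pairs, or ''cells'', $(i,j)\in S\times T$) and a set $E_2$ of 2-edges. A 2-edge is a quadruple $(i,j;k,l)$ with $i,k\in S$, $j,l\in T$, where the case $i=k$ and $j=l$ is forbidden; it is regarded as an unordered pair of the two distinct cells $(i,j)$ and $(k,l)$, called its halves. It is nondegenerate if $i\ne k$ and $j\ne l$, row-degenerate if $i=k$ and $j\neq l$, and column-degenerate if $i\ne k$ and $j=l$. The simplicity condition is imposed: no 2-edge shares a cell with any 1-edge or with another 2-edge. **Generalized $C_4$-cycles.** A cell $(i,j)$ is occupied if $(i,j)\in E_1$ or $(i,j)$ is a half of some 2-edge in $E_2$. The graph $G$ contains a generalized $C_4$-cycle if any of the following holds: 1. There is a classical $C_4$-cycle formed by 1-edges. 2. There is a nondegenerate 2-edge $(i,j;k,l)\in E_2$ such that both cells $(i,l)$ and $(k,j)$ are occupied. 3. There are a 2-edge $(i,j;p,q)\in E_2$ (of any type) and a cell $(k,l)$ with $k\notin\{i,p\}$ and $l\notin\{j,q\}$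 such that the five cells $(k,l),(k,j),(k,q),(i,l),(p,l)$ are all occupied; if the 2-edge is nondegenerate, these five cells must moreover be pairwise distinct. **Limited augmented Zarankiewicz number.** $z_L(m,n)$ is the maximum of $|E_1|+|E_2|$ over all $m\times n$ limited augmented bipartite graphs $G=(S,T,E_1\cup E_2)$ (augmented from a $C_4$-free graph with $|E_1|=z(m,n)$, satisfying the simplicity condition) that contain no generalized $C_4$-cycle. *)

(* Defs.v *)
From mathcomp Require Import all_boot.

Set Implicit Arguments.
Unset Strict Implicit.
Unset Printing Implicit Defensive.

Notation cell m n := ('I_m * 'I_n)%type.

(* A bipartite graph with parts 'I_m and 'I_n is given by its set of edges,
   each edge being a cell; C4 is the same graph as K_{2,2}. *)
Definition has_C4 (m n : nat) (E : {set cell m n}) : bool :=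
  [exists i : 'I_m, exists k : 'I_m, exists j : 'I_n, exists l : 'I_n,
    [&& i != k, j != l, (i, j) \in E, (i, l) \in E, (k, j) \in E
      & (k, l) \in E]].

Definition zarankiewicz (m n : nat) : nat :=
  \max_(E : {set cell m n} | ~~ has_C4 E) #|E|.

(* The 2-edge (i,j;k,l), as the unordered pair of its halves. *)
Definition two_edge (m n : nat) (i : 'I_m) (j : 'I_n) (k : 'I_m) (l : 'I_n) :
    {set cell m n} :=
  [set (i, j); (k, l)].

(* Cardinality 2 excludes the forbidden case i = k and j = l. *)
Definition is_two_edge (m n : nat) (e : {set cell m n}) : bool := #|e| == 2.

Definition simple (m n : nat) (E1 : {set cell m n})
    (E2 : {set {set cell m n}}) : bool :=
  [forall e in E2, [disjoint e & E1]] && trivIset E2.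

Definition limited_augmented (m n : nat) (E1 : {set cell m n})
    (E2 : {set {set cell m n}}) : bool :=
  [&& ~~ has_C4 E1, #|E1| == zarankiewicz m n,
      [forall e in E2, is_two_edge e] & simple E1 E2].

Definition occupied (m n : nat) (E1 : {set cell m n})
    (E2 : {set {set cell m n}}) (c : cell m n) : bool :=
  (c \in E1) || [exists e in E2, c \in e].

Definition nondegenerate (m n : nat) (i : 'I_m) (j : 'I_n) (k : 'I_m)
    (l : 'I_n) : bool :=
  (i != k) && (j != l).

Definition gen_C4_two (m n : nat) (E1 : {set cell m n})
    (E2 : {set {set cell m n}}) : bool :=
  [exists i : 'I_m, exists j : 'I_n, exists k : 'I_m, exists l : 'I_n,
    [&& two_edge i j k l \in E2, nondegenerate i j k l,
        occupied E1 E2 (i, l) & occupied E1 E2 (k, j)]].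

Definition gen_C4_five (m n : nat) (E1 : {set cell m n})
    (E2 : {set {set cell m n}}) : bool :=
  [exists i : 'I_m, exists j : 'I_n, exists p : 'I_m, exists q : 'I_n,
   exists k : 'I_m, exists l : 'I_n,
    let five : seq (cell m n) :=
      [:: (k, l); (k, j); (k, q); (i, l); (p, l)] in
    [&& two_edge i j p q \in E2, k \notin [:: i; p], l \notin [:: j; q],
        all (occupied E1 E2) five & nondegenerate i j p q ==> uniq five]].

Definition has_gen_C4 (m n : nat) (E1 : {set cell m n})
    (E2 : {set {set cell m n}}) : bool :=
  [|| has_C4 E1, gen_C4_two E1 E2 | gen_C4_five E1 E2].

(* The range is nonempty: take E1 extremal and E2 empty. *)
Definition limited_zarankiewicz (m n : nat) : nat :=
  \max_(G : {set cell m n} * {set {set cell m n}}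
        | limited_augmented G.1 G.2 && ~~ has_gen_C4 G.1 G.2)
     (#|G.1| + #|G.2|).

(* Main.v *)
Require Import Defs.
From mathcomp Require Import all_boot.
From mathcomp Require Import zify.

(** A C4-free graph on 6 + 4 vertices uses each of the 6 pairs of columns in at
most one row, so its row degrees r satisfy 'C(r_1, 2) + ... + 'C(r_6, 2) <= 6.
Since r <= 'C(r, 2) + 1, with equality exactly for r = 1, 2, there are at most
12 edges, and 12 edges force every row to have degree 2. The six rows are then
the six pairs of columns, each once: up to the order of the rows, the extremal
graph is the incidence relation between the edges and the vertices of K4
([extremal_is_K4]).

It remains to see how many 2-edges fit on the 12 blank cells. Write ab.c for
the cell in row ab and column c, where a, b, c, d are the vertices of K4 in any
order; it is blank when c is not a or b. Two is possible ([K4_witness]). Three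
is not, for the following reason.

 - Blanks ab.d, ac.d of one column cannot be paired: the row ad and the column
   a complete a generalized C4. Blanks ab.c, cd.a of disjoint rows, and blanks
   ab.c, ac.b, cannot be paired either: both opposite corners are 1-edges. So
   every 2-edge is a row pair ab.c, ab.d or a twist ab.c, ac.d.
 - A row pair ab.c, ab.d keeps cd.a, cd.b, ac.d, ad.c, bc.d and bd.c empty. Two
   further 2-edges would have to use exactly ac.b, ad.b, bc.a and bd.a, where
   ac.b has no possible partner.
 - A twist ab.c, ac.d keeps ab.d, ad.c and cd.a empty, allows one occupied
   blank in row bc and one in row bd, and does not allow ac.b together with any
   of bc.d, bd.c, cd.b. If ac.b is occupied, the other two 2-edges use again
   ac.b, ad.b, bc.a and bd.a, which is impossible. Otherwise they use ad.b,
   cd.b, one blank of row bc and one of row bd; the first point leaves only the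
   2-edges ad.b, bd.c and cd.b, bc.a, and the twist db.c, da.b keeps cd.b empty.

More 2-edges only make more cells occupied, so a generalized C4 found in a
subfamily survives in the whole family. This makes the impossibility a finite
check on pairs of 2-edges, [no_three_two_edges], where compatibility of pairs
alone already excludes triples. *)

Set Implicit Arguments.
Unset Strict Implicit.
Unset Printing Implicit Defensive.

(** * Enumerations that evaluate *)

(** The enumeration [enum 'I_n] does not reduce in the kernel; [insub_eq] is
the transparent form of [insub], which makes this list reduce. *)
Definition ords n : seq 'I_n := pmap (insub_eq _) (iota 0 n).

Lemma mem_ords n (i : 'I_n) : i \in ords n.
Proof.
rewrite /ords (eq_pmap (insub_eqE _)) mem_pmap_sub mem_iota add0n /=.
exact: ltn_ord.
Qed.

Lemma uniq_ords n : uniq (ords n).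
Proof.
by rewrite /ords (eq_pmap (insub_eqE _)) pmap_sub_uniq ?iota_uniq.
Qed.

Definition cells m n : seq (cell m n) := [seq (i, j) | i <- ords m, j <- ords n].

Lemma mem_cells m n (c : cell m n) : c \in cells m n.
Proof. by case: c => i j; apply: allpairs_f; apply: mem_ords. Qed.

Lemma uniq_cells m n : uniq (cells m n).
Proof. by apply: allpairs_uniq; rewrite ?uniq_ords // => -[? ?] [? ?]. Qed.

Lemma card_count (T : finType) (s : seq T) (P : pred T) :
  uniq s -> (forall x, x \in s) -> #|[set x | P x]| = count P s.
Proof.
move=> s_uniq s_full; rewrite -size_filter.
rewrite -(card_uniqP (filter_uniq P s_uniq)) cardsE.
by apply: eq_card => x; rewrite mem_filter s_full andbT.
Qed.

(** * Extremal graphs *)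

Definition row_set m n (E : {set cell m n}) (i : 'I_m) : {set 'I_n} :=
  [set j | (i, j) \in E].

Lemma sum_card_rows m n (E : {set cell m n}) : \sum_i #|row_set E i| = #|E|.
Proof.
rewrite -sum1_card (eq_bigl (fun c => (c.1, c.2) \in E)); last by case.
rewrite -(pair_big_dep xpredT (fun i j => (i, j) \in E) (fun _ _ => 1)) /=.
by apply: eq_bigr => i _; rewrite -sum1dep_card.
Qed.

Lemma C4_free_pair m n (E : {set cell m n}) (A : {set 'I_n}) (i k : 'I_m) :
  ~~ has_C4 E -> #|A| == 2 -> A \subset row_set E i -> A \subset row_set E k -> i = k.
Proof.
move=> C4_free; case/cards2P=> [j [l [jl ->]]]; rewrite !subUset !sub1set !inE.
case/andP=> ij il /andP[kj kl]; apply: contraNeq C4_free => ik.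
apply/existsP; exists i; apply/existsP; exists k.
by apply/existsP; exists j; apply/existsP; exists l; apply/and5P; split=> //; apply/andP.
Qed.

(** Double counting of the pairs (row, 2-set of columns inside the row): a
2-set that lies in two rows is a C4. *)
Lemma sum_bin_rows m n (E : {set cell m n}) :
  ~~ has_C4 E -> \sum_i 'C(#|row_set E i|, 2) <= 'C(n, 2).
Proof.
move=> C4_free; under eq_bigr => i _ do rewrite -cards_draws -sum1dep_card.
rewrite (exchange_big_dep (fun A : {set 'I_n} => #|A| == 2)) /=; last first.
  by move=> i A _ /andP[].
rewrite -[n in 'C(n, 2)]card_ord -card_draws -sum1dep_card.
apply: leq_sum => A A2; rewrite sum1dep_card.
apply/card_le1_eqP => i k; rewrite !inE A2 !andbT.
by move=> A_i A_k; apply: (C4_free_pair C4_free A2).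
Qed.

(** The difference of the two sides is (r - 1)(r - 2)/2, which is nonnegative and
vanishes exactly at r = 1 and r = 2. *)
Lemma leqif_bin2 r : r <= 'C(r, 2).+1 ?= iff (r \in [:: 1; 2]).
Proof.
case: r => [|[|[|r]]] //.
have r_lt : r.+3 < 'C(r.+3, 2).+1.
  by rewrite !binS !bin0 bin1; lia.
by split; [apply: ltnW | rewrite (ltn_eqF r_lt)].
Qed.

(** The bound 12 comes from six pairs of columns and the summand 1 of
[leqif_bin2] in each of the six rows. Equality puts all degrees in {1, 2}, and
then a total of 12 over six rows makes them all 2. *)
Lemma C4_free_6_4 (E : {set cell 6 4}) :
  ~~ has_C4 E -> #|E| <= 12 ?= iff [forall i, #|row_set E i| == 2].
Proof.
move=> C4_free; pose r i := #|row_set E i|.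
have sum_r : \sum_i r i = #|E| := sum_card_rows E.
have [le_r eq_r] : \sum_i r i <= \sum_i 'C(r i, 2).+1
    ?= iff [forall (i | true), r i \in [:: 1; 2]].
  by apply: leqif_sum => i _; apply: leqif_bin2.
have sum_bin : \sum_i 'C(r i, 2).+1 <= 12.
  under eq_bigr => i _ do rewrite -addn1.
  rewrite big_split /= sum1_card card_ord -[12]/(6 + 6) leq_add2r.
  exact: sum_bin_rows.
have le12 : #|E| <= 12 by rewrite -sum_r; apply: leq_trans le_r _.
split=> //; apply/eqP/forallP => [E12 | r2]; last first.
  rewrite -sum_r (eq_bigr (fun=> 2)) => [|i _]; last exact/eqP/r2.
  by rewrite sum_nat_const card_ord.
have /forallP r12 : [forall (i | true), r i \in [:: 1; 2]].
  by rewrite -eq_r eqn_leq le_r /= sum_r E12.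
have [_ eq2] : \sum_i r i <= \sum_(i < 6) 2
    ?= iff [forall (i | true), r i == 2].
  apply: leqif_sum => i _; apply: leqif_eq.
  by have := r12 i; rewrite !inE => /orP[] /eqP->.
move: eq2; rewrite sum_r E12 sum_nat_const card_ord eqxx.
by move/esym/forallP.
Qed.

(** Row i of the model is the i-th edge of K4 on the vertices 0, 1, 2, 3. *)
Definition K4_edges : seq (seq nat) :=
  [:: [:: 0; 1]; [:: 0; 2]; [:: 0; 3]; [:: 1; 2]; [:: 1; 3]; [:: 2; 3]].

Definition K4 (c : cell 6 4) : bool := val c.2 \in nth [::] K4_edges c.1.

Lemma K4_extremal : ~~ has_C4 [set c | K4 c] /\ #|[set c | K4 c]| = 12.
Proof.
split; last by rewrite (card_count _ (uniq_cells 6 4) (@mem_cells 6 4)).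
apply/existsP => -[i /existsP[k /existsP[j /existsP[l]]]]; rewrite !inE.
apply/negP.
have /allP/(_ _ (mem_cells (i, k)))/allP/(_ _ (mem_cells (j, l))) //:
  all (fun a : 'I_6 * 'I_6 => all (fun b : 'I_4 * 'I_4 =>
    ~~ [&& a.1 != a.2, b.1 != b.2, K4 (a.1, b.1), K4 (a.1, b.2), K4 (a.2, b.1)
         & K4 (a.2, b.2)]) (cells 4 4)) (cells 6 6).
by vm_compute.
Qed.

Lemma zarankiewicz_6_4 : zarankiewicz 6 4 = 12.
Proof.
have [K4_no_C4 card_K4] := K4_extremal.
apply/eqP; rewrite eqn_leq -{2}card_K4 leq_bigmax_cond // andbT.
by apply/bigmax_leqP => E /C4_free_6_4[].
Qed.

(** The rows of an extremal graph are distinct 2-sets, six of them, hence all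
2-sets of columns. Only the rows need renaming, since every pair of columns is
a row. *)
Lemma extremal_is_K4 (E : {set cell 6 4}) :
  ~~ has_C4 E -> #|E| = 12 ->
  exists2 s : 'I_6 -> 'I_6, injective s & forall i j, ((s i, j) \in E) = K4 (i, j).
Proof.
move=> C4_free E12.
have row2 i : #|row_set E i| == 2.
  have [_ rows2] := C4_free_6_4 C4_free.
  by move: rows2; rewrite E12 => /esym/forallP.
have row_inj : injective (row_set E).
  by move=> i k eq_ik; apply: (C4_free_pair C4_free (row2 i)); rewrite // eq_ik.
have rows_all : row_set E @: 'I_6 = [set A : {set 'I_4} | #|A| == 2].
  apply/eqP; rewrite eqEcard card_imset // card_draws !card_ord andbT.
  by apply/subsetP => _ /imsetP[i _ ->]; rewrite inE.
pose line i := [set j | K4 (i, j)].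
have line2 i : #|line i| == 2.
  rewrite (card_count _ (uniq_ords 4) (@mem_ords 4)).
  have /allP/(_ _ (mem_ords i)) //: all (fun i : 'I_6 =>
    count (fun j => K4 (i, j)) (ords 4) == 2) (ords 6).
  by vm_compute.
have [s s_row] : exists s, forall i, row_set E (s i) = line i.
  apply: (@fin_all_exists _ _ (fun i k => row_set E k = line i)) => i.
  have /imsetP[k _ ->] : line i \in row_set E @: 'I_6 by rewrite rows_all inE.
  by exists k.
have sE i j : ((s i, j) \in E) = K4 (i, j).
  by have /setP/(_ j) := s_row i; rewrite !inE.
exists s => // i k eq_s; apply/eqP.
have eq_K4 j : K4 (i, j) = K4 (k, j) by rewrite -!sE eq_s.
have /allP/(_ _ (mem_cells (i, k)))/implyP-> //: all (fun a : 'I_6 * 'I_6 =>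
  all (fun j => K4 (a.1, j) == K4 (a.2, j)) (ords 4) ==> (a.1 == a.2)) (cells 6 6).
  by vm_compute.
by apply/allP => j _; apply/eqP.
Qed.

(** * Generalized C4-cycles through one 2-edge *)

Definition five_cells m n (x y c : cell m n) : seq (cell m n) :=
  [:: c; (c.1, x.2); (c.1, y.2); (x.1, c.2); (y.1, c.2)].

(** The two conditions on a 2-edge with halves x and y, for an arbitrary
occupation o. Keeping o abstract lets one definition serve for the graph and
for a family of 2-edges of the model. *)
Definition clash m n (o : pred (cell m n)) (x y : cell m n) : bool :=
  let nd := nondegenerate x.1 x.2 y.1 y.2 in
  [&& nd, o (x.1, y.2) & o (y.1, x.2)] ||
  has (fun c => [&& c.1 \notin [:: x.1; y.1], c.2 \notin [:: x.2; y.2],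
                   all o (five_cells x y c) & nd ==> uniq (five_cells x y c)])
      (cells m n).

Lemma gen_C4P m n (E1 : {set cell m n}) (E2 : {set {set cell m n}}) :
  reflect (exists x y, [set x; y] \in E2 /\ clash (occupied E1 E2) x y)
          (gen_C4_two E1 E2 || gen_C4_five E1 E2).
Proof.
apply: (iffP orP) => [[] | [[i j] [[p q] [xy /orP[ok|]]]]].
- case/existsP=> i /existsP[j /existsP[p /existsP[q /andP[xy ok]]]].
  by exists (i, j), (p, q); split=> //; apply/orP; left.
- case/existsP=> i /existsP[j /existsP[p /existsP[q /existsP[k /existsP[l]]]]].
  case/andP=> xy ok.
  exists (i, j), (p, q); split=> //; apply/orP; right.
  by apply/hasP; exists (k, l); first exact: mem_cells.
- left; apply/existsP; exists i; apply/existsP; exists j.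
  by apply/existsP; exists p; apply/existsP; exists q; apply/andP.
case/hasP=> -[k l] _ ok; right; apply/existsP; exists i; apply/existsP; exists j.
apply/existsP; exists p; apply/existsP; exists q.
by apply/existsP; exists k; apply/existsP; exists l; apply/andP.
Qed.

(** Both conditions only ask for occupied cells and for inequalities, so they
survive a renaming of the rows and an increase of the occupation. *)
Lemma clash_reindex m n (s : 'I_m -> 'I_m) (o o' : pred (cell m n)) x y :
  injective s -> (forall i j, o (i, j) -> o' (s i, j)) ->
  clash o x y -> clash o' (s x.1, x.2) (s y.1, y.2).
Proof.
move=> s_inj oo'; pose f (c : cell m n) := (s c.1, c.2).
have f_inj : injective f by move=> [i j] [k l] [/s_inj-> ->].
have s_eq i k : (s i == s k) = (i == k) := inj_eq s_inj i k.
have nd_f : nondegenerate (f x).1 (f x).2 (f y).1 (f y).2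
    = nondegenerate x.1 x.2 y.1 y.2 by rewrite /nondegenerate /= s_eq.
rewrite -/(f x) -/(f y) /clash nd_f.
case/orP=> [/and3P[nd o1 o2] | /hasP[c _ /and4P[c1 c2 o5 u5]]].
  by rewrite nd !oo'.
apply/orP; right; apply/hasP; exists (f c); first exact: mem_cells.
rewrite -[five_cells _ _ _]/(map f (five_cells x y c)).
rewrite map_inj_uniq // u5 andbT all_map.
move: c1 c2; rewrite !inE !s_eq => -> ->.
by apply: sub_all o5 => -[i j]; apply: oo'.
Qed.

(** * Three 2-edges cannot coexist *)

Definition two_edges : Type := seq (cell 6 4 * cell 6 4).

Definition halves (es : two_edges) : seq (cell 6 4) :=
  flatten [seq [:: e.1; e.2] | e <- es].

Definition K4_occ (es : two_edges) : pred (cell 6 4) :=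
  fun c => K4 c || (c \in halves es).

(** Simplicity, together with the absence of generalized C4-cycles, of the
model augmented by es. *)
Definition admissible (es : two_edges) : bool :=
  uniq (halves es) && ~~ has (fun e => clash (K4_occ es) e.1 e.2) es.

Definition blanks : seq (cell 6 4) := [seq c <- cells 6 4 | ~~ K4 c].

Definition admissible_single : two_edges :=
  [seq e <- [seq (x, y) | x <- blanks, y <- blanks] | admissible [:: e]].

(** The graph of compatible 2-edges has no triangle; see the case analysis at
the top. Lazy reduction matters here: it stops a boolean connective at its
first decisive argument. *)
Lemma no_three_two_edges :
  all (fun e => let mates := [seq f <- admissible_single | admissible [:: e; f]] in
    all (fun f => all (fun g => ~~ admissible [:: f; g]) mates) mates) admissible_single.
Proof. by lazy. Qed.

Lemma K4_occP es c :
  reflect (K4 c \/ exists2 e, e \in es & c \in [:: e.1; e.2]) (K4_occ es c).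
Proof. by apply: (iffP orP) => -[?|/flatten_mapP ?]; [left | right | left | right]. Qed.

(** The 2-edge of the actual graph that corresponds to e when row i of the
model is row s i of the graph. *)
Definition placed (s : 'I_6 -> 'I_6) (e : cell 6 4 * cell 6 4) :
    {set cell 6 4} :=
  [set (s e.1.1, e.1.2); (s e.2.1, e.2.2)].

Lemma mem_placed s e c : c \in [:: e.1; e.2] -> (s c.1, c.2) \in placed s e.
Proof. by rewrite !inE => /orP[] /eqP->; rewrite eqxx ?orbT. Qed.

Lemma uniq_halves s es (E2 : {set {set cell 6 4}}) :
  injective s -> trivIset E2 -> {in E2, forall A, is_two_edge A} ->
  {subset map (placed s) es <= E2} -> uniq (map (placed s) es) ->
  uniq (halves es).
Proof.
move=> s_inj triv two_E2; elim: es => //= e es IHes es_E2 /andP[e_es es_uniq].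
have e_E2 : placed s e \in E2 by apply: es_E2; rewrite mem_head.
have es_sub : {subset map (placed s) es <= E2}.
  by move=> A A_es; apply: es_E2; rewrite inE A_es orbT.
have e_new c : c \in [:: e.1; e.2] -> c \notin halves es.
  move=> c_e; apply/flatten_mapP => -[g g_es c_g].
  have g_E2 : placed s g \in E2 by apply/es_sub/map_f.
  have ne_eg : placed s e != placed s g.
    by apply: contraNneq e_es => ->; apply: map_f.
  have := disjointFr (trivIsetP triv _ _ e_E2 g_E2 ne_eg) (mem_placed s c_e).
  by rewrite mem_placed.
rewrite IHes // inE negb_or !e_new ?inE ?eqxx ?orbT // !andbT.
apply: contraTneq (two_E2 _ e_E2) => eq_e.
by rewrite /is_two_edge cards2 eq_e eqxx.
Qed.

(** A clash inside a subfamily es of E2 is a clash for E2, whose occupation is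
larger. *)
Lemma admissible_placed s es (E1 : {set cell 6 4}) (E2 : {set {set cell 6 4}}) :
  injective s -> (forall i j, ((s i, j) \in E1) = K4 (i, j)) ->
  limited_augmented E1 E2 -> ~~ has_gen_C4 E1 E2 ->
  {subset map (placed s) es <= E2} -> uniq (map (placed s) es) -> admissible es.
Proof.
move=> s_inj sE /and4P[_ _ /forall_inP two_E2 /andP[_ triv]].
rewrite negb_or => /andP[_ /gen_C4P no_clash] es_E2 es_uniq.
apply/andP; split; first exact: uniq_halves es_E2 es_uniq.
apply/hasP => -[e e_es clash_e]; case: no_clash.
exists (s e.1.1, e.1.2), (s e.2.1, e.2.2); split; first exact/es_E2/map_f.
apply: clash_reindex s_inj _ clash_e => i j /K4_occP[K4_ij | [g g_es c_g]].
  by rewrite /occupied sE K4_ij.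
apply/orP; right; apply/exists_inP; exists (placed s g).
  exact/es_E2/map_f.
exact: mem_placed c_g.
Qed.

(** By simplicity the halves of a 2-edge avoid E1, so they correspond to
blanks. *)
Lemma placed_surj s (E1 : {set cell 6 4}) (E2 : {set {set cell 6 4}}) A :
  injective s -> (forall i j, ((s i, j) \in E1) = K4 (i, j)) ->
  limited_augmented E1 E2 -> A \in E2 ->
  exists2 e, e \in [seq (x, y) | x <- blanks, y <- blanks] & A = placed s e.
Proof.
move=> s_inj sE /and4P[_ _ /forall_inP two_E2 /andP[/forall_inP disj _]] A_E2.
have /cards2P[x [y [_ def_A]]] := two_E2 _ A_E2.
pose back (c : cell 6 4) := (invF s_inj c.1, c.2).
have backK c : (s (back c).1, (back c).2) = c.
  by rewrite /= f_invF -surjective_pairing.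
have blank c : c \in A -> back c \in blanks.
  move=> c_A; rewrite mem_filter mem_cells andbT.
  by rewrite (surjective_pairing (back c)) -sE backK (disjointFr (disj _ A_E2)).
exists (back x, back y); last by rewrite /placed !backK.
by apply: allpairs_f; apply: blank; rewrite def_A !inE eqxx ?orbT.
Qed.

Lemma card_two_edges (E1 : {set cell 6 4}) (E2 : {set {set cell 6 4}}) :
  limited_augmented E1 E2 -> ~~ has_gen_C4 E1 E2 -> #|E2| <= 2.
Proof.
move=> aug no_gen; have /and4P[C4_free /eqP E1_max _ _] := aug.
rewrite zarankiewicz_6_4 in E1_max.
have [s s_inj sE] := extremal_is_K4 C4_free E1_max.
have free es := admissible_placed (es := es) s_inj sE aug no_gen.
rewrite leqNgt; apply/negP => /card_gt2P[A [B [C [[AE BE CE] [AB BC CA]]]]].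
have [e e_bl def_A] := placed_surj s_inj sE aug AE.
have [g g_bl def_B] := placed_surj s_inj sE aug BE.
have [h h_bl def_C] := placed_surj s_inj sE aug CE.
have single e0 : e0 \in [seq (x, y) | x <- blanks, y <- blanks] ->
    placed s e0 \in E2 -> e0 \in admissible_single.
  move=> e0_bl e0E; rewrite mem_filter e0_bl andbT; apply: free => //.
  by move=> D; rewrite inE => /eqP->.
have compatible e0 e1 : placed s e0 \in E2 -> placed s e1 \in E2 ->
    placed s e0 != placed s e1 -> admissible [:: e0; e1].
  move=> e0E e1E ne; apply: free; last by rewrite /= inE ne.
  by move=> D; rewrite !inE => /orP[] /eqP->.
rewrite {}def_A {}def_B {}def_C in AE BE CE AB BC CA.
have /allP/(_ e (single _ e_bl AE))/allP/(_ g) := no_three_two_edges.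
rewrite mem_filter compatible // single // => /(_ isT)/allP/(_ h).
rewrite mem_filter (compatible e h) // 1?eq_sym // single // compatible //.
by move=> /(_ isT).
Qed.

(** * Two 2-edges can coexist *)

(** With vertices 0, 1, 2, 3 named a, b, c, d, these are the twists ab.c, ac.d
and ad.b, bd.c. *)
Definition K4_witness : two_edges :=
  [:: ((@Ordinal 6 0 isT, @Ordinal 4 2 isT), (@Ordinal 6 1 isT, @Ordinal 4 3 isT));
      ((@Ordinal 6 2 isT, @Ordinal 4 1 isT), (@Ordinal 6 4 isT, @Ordinal 4 2 isT))].

Definition as_sets (es : two_edges) : {set {set cell 6 4}} :=
  [set A in [seq [set e.1; e.2] | e <- es]].

Lemma as_setsP es A :
  reflect (exists2 e, e \in es & A = [set e.1; e.2]) (A \in as_sets es).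
Proof. by rewrite inE; apply: mapP. Qed.

Lemma occupied_K4 es : occupied [set c | K4 c] (as_sets es) =1 K4_occ es.
Proof.
move=> c; apply/idP/K4_occP => [/orP[|/exists_inP[_ /as_setsP[e e_es ->]]] |].
- by rewrite inE; left.
- by rewrite !inE => c_e; right; exists e; rewrite ?inE.
rewrite /occupied inE => -[-> // | [e e_es c_e]]; apply/orP; right.
apply/exists_inP; exists [set e.1; e.2]; first by apply/as_setsP; exists e.
by move: c_e; rewrite !inE.
Qed.

(** The set of halves does not determine the order of the two halves, so both
orders are tested. *)
Lemma K4_witness_clash_free :
  all (fun e => all (fun x => all (fun y =>
    (x == y) || ~~ clash (K4_occ K4_witness) x y) [:: e.1; e.2]) [:: e.1; e.2])
    K4_witness.
Proof. by lazy. Qed.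

Lemma K4_witness_valid :
  let E1 := [set c | K4 c] in let E2 := as_sets K4_witness in
  [/\ limited_augmented E1 E2, ~~ has_gen_C4 E1 E2 & #|E2| = 2].
Proof.
move=> E1 E2; have [K4_C4 card_K4] := K4_extremal.
have two_E2 A : A \in E2 -> #|A| == 2.
  case/as_setsP=> e e_es ->; rewrite cards2.
  by move: e e_es; apply/allP; lazy.
have pair_eq e g x : e \in K4_witness -> g \in K4_witness ->
    x \in [:: e.1; e.2] -> x \in [:: g.1; g.2] -> e = g.
  move=> e_es g_es x_e x_g; apply/eqP.
  have /allP/(_ e e_es)/allP/(_ g g_es)/allP/(_ x x_e)/implyP-> //:
    all (fun e => all (fun g => all (fun x => (x \in [:: g.1; g.2]) ==> (e == g))
      [:: e.1; e.2]) K4_witness) K4_witness by lazy.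
split.
- rewrite /limited_augmented K4_C4 zarankiewicz_6_4 card_K4 eqxx /=.
  apply/and3P; split; first by apply/forall_inP.
    apply/forall_inP => _ /as_setsP[e e_es ->]; rewrite disjoints_subset.
    by rewrite subUset !sub1set !inE; move: e e_es; apply/allP; lazy.
  apply/trivIsetP => _ _ /as_setsP[e e_es ->] /as_setsP[g g_es ->].
  apply: contraNT => /pred0Pn[x /andP[]]; rewrite /= !inE => x_e x_g.
  by rewrite (pair_eq e g x) // !inE.
- rewrite /has_gen_C4 (negPf K4_C4) /=; apply/gen_C4P => -[x [y [xy clash_xy]]].
  have ne_xy : x != y by have := two_E2 _ xy; rewrite cards2; case: (x == y).
  have /as_setsP[e e_es def_e] := xy.
  have [x_e y_e] : x \in [:: e.1; e.2] /\ y \in [:: e.1; e.2].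
    have /setP eq_e := def_e; have [ex ey] := (eq_e x, eq_e y).
    by move: ex ey; rewrite !inE !eqxx orbT => <- <-.
  have := allP (allP (allP K4_witness_clash_free e e_es) x x_e) y y_e.
  rewrite (negPf ne_xy) /=; case/negP.
  have := @clash_reindex 6 4 id _ (K4_occ K4_witness) x y (@inj_id _) _ clash_xy.
  by rewrite -!surjective_pairing; apply => i j; rewrite occupied_K4.
rewrite cardsE; have /card_uniqP-> // : uniq [seq [set e.1; e.2] | e <- K4_witness].
rewrite map_inj_in_uniq // => e g e_es g_es /setP/(_ e.1).
rewrite !inE eqxx => /esym e_g.
by apply: (pair_eq e g e.1) => //; rewrite !inE ?eqxx.
Qed.

Theorem theorem4p1 : limited_zarankiewicz 6 4 = 14.
Proof.
apply/eqP; rewrite eqn_leq; apply/andP; split.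
  apply/bigmax_leqP => -[E1 E2] /= /andP[aug free].
  have /and4P[_ /eqP-> _ _] := aug; rewrite zarankiewicz_6_4 -[14]/(12 + 2).
  by rewrite leq_add2l; apply: card_two_edges aug free.
have [aug free card_E2] := K4_witness_valid.
have [_ card_E1] := K4_extremal.
apply: (bigmax_sup ([set c | K4 c], as_sets K4_witness)); rewrite /= ?aug //.
by rewrite card_E1 card_E2.
Qed.
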